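(* Assume that for every time step $t\in[T]$ and every state $s_t$ the set function $F_t(\cdot;s_t):2^{\Omega_t}\to\mathbb R_{\ge0}$ is normalized, monotone and submodular, and that $\mathcal A_i\ne\emptyset$ for all $i\in\mathcal N_t$. Then, at each time step $t$ and state $s_t$, $$\max_{x\in\mathcal P(\mathcal I_t)}\tilde f_t(x;s_t)=\max_{x\in\mathcal F_t}\tilde f_t(x;s_t)=\max_{A\in\mathcal I_t}F_t(A;s_t).$$
   Context: For each $t\in[T]=\{1,\dots,T\}$, $\mathcal N_t$ is a finite set of active agents, each agent $i$ has a finite action set $\mathcal A_i$; $\Omega_t=\{(i,a):i\in\mathcal N_t,\ a\in\mathcal A_i\}$, $\Omega_{i,t}=\{(i,a):a\in\mathcal A_i\}$, and $\mathcal I_t=\{A\subseteq\Omega_t:|A\cap\Omega_{i,t}|\le1\ \forall i\in\mathcal N_t\}$. $F_t(\cdot;s_t)$ is the stage utility at state $s_t$. A set function $F$ is normalized if $F(\emptyset)=0$, monotone if $A\subseteq A'\Rightarrow F(A)\le F(A')$, and submodular if $F(A\cup\{e\})-F(A)\ge F(A'\cup\{e\})-F(A')$ for $A\subseteq A'$, $e\notin A'$. Polytope: $\mathcal P(\mathcal I_t)=\{x\in[0,1]^{\Omega_t}:\sum_{a\in\mathcal A_i}x_{(i,a)}\le1\ \forall i\in\mathcal N_t\}$. Categorical-policy face: $\mathcal F_t=\{x\in\mathcal P(\mathcal I_t):\sum_{a\in\mathcal A_i}x_{(i,a)}=1\ \forall i\in\mathcal N_t\}$. Partition multilinear extension: for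 $x\in\mathcal P(\mathcal I_t)$, $$\tilde f_t(x;s_t)=\sum_{A\in\mathcal I_t}F_t(A;s_t)\prod_{i\in\mathcal N_t}p_i(A;x),$$ where $p_i(A;x)=x_{(i,a)}$ if $A\cap\Omega_{i,t}=\{(i,a)\}$ and $p_i(A;x)=1-\sum_{a'\in\mathcal A_i}x_{(i,a')}$ if $A\cap\Omega_{i,t}=\emptyset$. *)

(* Defs.v *)
From mathcomp Require Import all_boot all_order all_algebra.
From mathcomp Require Import finmap.
From mathcomp Require Import boolp classical_sets reals.

Set Implicit Arguments.
Unset Strict Implicit.
Unset Printing Implicit Defensive.

Import Order.TTheory GRing.Theory Num.Theory.
Local Open Scope ring_scope.

(* Throughout, the active agents at a given time form a finite type Ag, and the
   ground set is itself a type, so that {set ground Act} is its power set and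
   {ffun ground Act -> R} is exactly the space of vectors indexed by it. *)

Section PartitionGround.
Variables (Ag : finType) (Act : Ag -> finType).

Definition ground := {i : Ag & Act i}.

Definition block (i : Ag) : {set ground} :=
  [set Tagged Act a | a : Act i]%SET.

Definition indep : {set {set ground}} :=
  [set A : {set ground} | [forall i, #|A :&: block i| <= 1]%N]%SET.

End PartitionGround.

(* N is coerced to the finite type of its elements, playing the role of Ag. *)
Definition active_actions (Agent : choiceType) (N : {fset Agent})
  (Act : Agent -> finType) : N -> finType := fun i => Act (val i).

Arguments active_actions {Agent} N Act.

Section SetFunctions.
Variables (R : realType) (E : finType).
Implicit Type F : {set E} -> R.

Definition normalized F := F finset.set0 = 0.

Definition monotone_setfun F :=
  forall A B : {set E}, A \subset B -> F A <= F B.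

Definition submodular F :=
  forall (A B : {set E}) (e : E), A \subset B -> e \notin B ->
    F (A :|: [set e])%SET - F A >= F (B :|: [set e])%SET - F B.

End SetFunctions.

Section PartitionExtension.
Variables (R : realType) (Ag : finType) (Act : Ag -> finType).
Implicit Types (x : {ffun ground Act -> R}) (A : {set ground Act}).

Definition polytope : set {ffun ground Act -> R} :=
  [set x : {ffun ground Act -> R} |
    (forall e, 0 <= x e <= 1) /\
    (forall i, \sum_(a : Act i) x (Tagged Act a) <= 1)]%classic.

Definition policy_face : set {ffun ground Act -> R} :=
  [set x | polytope x /\
    forall i, \sum_(a : Act i) x (Tagged Act a) = 1]%classic.

(* The second branch is meant for A :&: block i = set0; when A \in indep these
   are the only two cases, and other sets A are never summed over. *)
Definition agent_weight (i : Ag) A x : R :=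
  if [pick a : Act i | A :&: block Act i == [set Tagged Act a]]%SET is Some a
  then x (Tagged Act a)
  else 1 - \sum_(a : Act i) x (Tagged Act a).

Definition multilinear_ext (F : {set ground Act} -> R) x : R :=
  \sum_(A in indep Act) F A * \prod_(i : Ag) agent_weight i A x.

End PartitionExtension.

Arguments polytope R {Ag} Act.
Arguments policy_face R {Ag} Act.

Definition is_max (R : realType) (V : set R) (m : R) := V m /\ ubound V m.

(* Main.v *)
(** For x in the polytope the products of agent weights are a probability
    distribution on the independent sets, so the extension is an average of the
    values F A and is at most their maximum. By monotonicity this maximum is
    reached at a set choosing exactly one action per agent; the indicator of
    such a set lies in the policy face, and there the distribution is a Dirac
    mass. *)
Require Import Defs.
From mathcomp Require Import all_boot all_order all_algebra.
From mathcomp Require Import finmap.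
From mathcomp Require Import boolp classical_sets reals.
Import Order.TTheory GRing.Theory Num.Theory.
Local Open Scope ring_scope.

Section PartitionWeights.
Set Implicit Arguments.
Unset Strict Implicit.
Unset Printing Implicit Defensive.
Variables (R : realType) (Ag : finType) (Act : Ag -> finType).
Implicit Types (x : {ffun ground Act -> R}) (A B : {set ground Act}).

Lemma in_block (i : Ag) (e : ground Act) : (e \in block Act i) = (tag e == i).
Proof.
apply/imsetP/eqP => [[a _ ->] //|].
by case: e => j a /= <-; exists a.
Qed.

Lemma block_partial_choice i B : B \subset block Act i -> (#|B| <= 1)%N ->
  B = finset.set0 \/ exists a : Act i, B = [set Tagged Act a]%SET.
Proof.
move=> sB; rewrite leq_eqVlt ltnS leqn0 cards_eq0 orbC.
case/orP => [/eqP->|/cards1P[e eB]]; first by left.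
move: sB; rewrite eB finset.sub1set => /imsetP[a _ ->].
by right; exists a.
Qed.

(** The weight of agent [i] depends on [A] only through its trace on the block of [i]; this is what
    makes the sum of products separable. *)
Lemma agent_weightI i A x :
  agent_weight i (A :&: block Act i)%SET x = agent_weight i A x.
Proof. by rewrite /agent_weight -finset.setIA finset.setIid. Qed.

Lemma agent_weight0 i x :
  agent_weight i finset.set0 x = 1 - \sum_(a : Act i) x (Tagged Act a).
Proof.
rewrite /agent_weight; case: pickP => // a.
by rewrite finset.set0I eq_sym => /eqP/finset.setP/(_ (Tagged Act a)); rewrite !inE eqxx.
Qed.

Lemma agent_weight_set1 i (a : Act i) x :
  agent_weight i [set Tagged Act a]%SET x = x (Tagged Act a).
Proof.
have aI : ([set Tagged Act a] :&: block Act i = [set Tagged Act a])%SET.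
  by apply/finset.setIidPl; rewrite finset.sub1set in_block.
rewrite /agent_weight aI; case: pickP => [b /eqP/finset.set1_inj -> //|/(_ a)].
by rewrite eqxx.
Qed.

Lemma agent_weight_ge0 i A x : polytope R Act x -> 0 <= agent_weight i A x.
Proof.
case=> x01 xle1; rewrite /agent_weight; case: pickP => [a _|_].
  by case/andP: (x01 (Tagged Act a)).
by rewrite subr_ge0.
Qed.

(** The admissible [B] are the empty set and the singletons of the block. The empty set carries
    exactly the mass that the singletons leave over, so the identity holds for every vector [x]. *)
Lemma sum_agent_weight i x :
  \sum_(B : {set ground Act} | (B \subset block Act i) && (#|B| <= 1)%N)
    agent_weight i B x = 1.
Proof.
rewrite (bigD1 finset.set0) ?finset.sub0set ?cards0 //= agent_weight0.
rewrite [X in _ + X](_ : _ = \sum_(a : Act i) x (Tagged Act a)) ?subrK //.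
rewrite (eq_bigl (fun B => B \in
    [set [set Tagged Act a]%SET | a in [set: Act i]%SET]%SET)); last first.
  move=> B; apply/idP/imsetP => [/andP[/andP[sB cB] B0]|[a _ ->]].
    case: (block_partial_choice sB cB) => [BE|[a ->]].
      by rewrite BE eqxx in B0.
    by exists a.
  by rewrite finset.sub1set in_block cards1 !eqxx /= -cards_eq0 cards1.
rewrite big_imset /=; last by move=> a b _ _ /finset.set1_inj /eqP; rewrite eq_Tagged => /eqP.
by apply: eq_big => [a|a _]; rewrite ?inE // agent_weight_set1.
Qed.

Lemma eq_blocks A B :
  (forall i, A :&: block Act i = B :&: block Act i)%SET -> A = B.
Proof.
move=> AB; apply/finset.setP => e; move/finset.setP/(_ e): (AB (tag e)).
by rewrite !inE in_block eqxx !andbT.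
Qed.

Lemma bigcup_blockI (f : {ffun Ag -> {set ground Act}}) (i : Ag) :
  (forall j, f j \subset block Act j) ->
  ((\bigcup_j f j) :&: block Act i = f i)%SET.
Proof.
move=> sf; apply/finset.setP => e; rewrite inE in_block; apply/andP/idP.
  case=> /finset.bigcupP[j _ ej] /eqP <-; move: (fintype.subsetP (sf j) e ej).
  by rewrite in_block => /eqP ->.
move=> ei; split; first by apply/finset.bigcupP; exists i.
by move: (fintype.subsetP (sf i) e ei); rewrite in_block.
Qed.

(* An independent set is the same thing as one partial choice per block, so the
   sum of the product weights factors agent by agent. *)
Lemma sum_prod_agent_weight x :
  \sum_(A in indep Act) \prod_(i : Ag) agent_weight i A x = 1.
Proof.
pose Q (i : Ag) (B : {set ground Act}) := (B \subset block Act i) && (#|B| <= 1)%N.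
transitivity (\prod_(i : Ag) \sum_(B | Q i B) agent_weight i B x); last first.
  by apply: big1 => i _; exact: sum_agent_weight.
rewrite (bigA_distr_big_dep Q) /=.
(* A set corresponds to the family of its traces on the blocks; the inverse map takes the union of
   the family. *)
rewrite (reindex (fun A => [ffun i : Ag => A :&: block Act i]%SET)) /=; last first.
  exists (fun f : {ffun Ag -> {set ground Act}} => (\bigcup_i f i)%SET) => [A _|f].
    apply: eq_blocks => i; rewrite bigcup_blockI ?ffunE // => j.
    by rewrite ffunE finset.subsetIr.
  move=> /familyP fQ; apply/ffunP => i; rewrite ffunE bigcup_blockI // => j.
  by have /andP[] := fQ j.
apply: eq_big => [A|A _].
  rewrite inE; apply/forallP/familyP => [AI i|AQ i].
    by rewrite ffunE; apply/andP; rewrite finset.subsetIr AI.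
  by have := AQ i; rewrite ffunE => /andP[].
by apply: eq_bigr => i _; rewrite ffunE agent_weightI.
Qed.

Lemma multilinear_ext_le (F : {set ground Act} -> R) (m : R) x :
  polytope R Act x -> (forall A, A \in indep Act -> F A <= m) ->
  multilinear_ext F x <= m.
Proof.
(* Spreading [m] over the total weight 1 reduces the bound to a termwise comparison with nonnegative
   weights. *)
move=> Px Fm; rewrite /multilinear_ext -[leRHS]mulr1 -[X in m * X](sum_prod_agent_weight x).
rewrite mulr_sumr; apply: ler_sum => A AI; apply: ler_wpM2r; last exact: Fm.
by apply: prodr_ge0 => i _; exact: agent_weight_ge0.
Qed.

(** These sets are the bases of the partition matroid when every agent has an action. *)
Definition choice_set (c : forall i, Act i) : {set ground Act} :=
  [set e | e == Tagged Act (c (tag e))]%SET.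

Lemma Tagged_choice_set c i (a : Act i) :
  (Tagged Act a \in choice_set c) = (a == c i).
Proof. by rewrite inE eq_Tagged. Qed.

Lemma choice_set_blockI c i :
  (choice_set c :&: block Act i = [set Tagged Act (c i)])%SET.
Proof.
apply/finset.setP => e; rewrite !inE in_block; apply/andP/eqP => [[/eqP eE /eqP eI]|->].
  by rewrite eE eI.
by rewrite !eqxx.
Qed.

Lemma choice_set_indep c : choice_set c \in indep Act.
Proof. by rewrite inE; apply/forallP => i; rewrite choice_set_blockI cards1. Qed.

Lemma indep_sub_choice_set A : (forall i, (0 < #|Act i|)%N) ->
  A \in indep Act -> exists c, A \subset choice_set c.
Proof.
move=> Act_gt0; rewrite inE => /forallP AI.
have a0 i : Act i by exact: enum_val (Ordinal (Act_gt0 i)).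
(* Keep the action that [A] selects for [i]; the default [a0 i] only fills the blocks that [A]
   misses. *)
pose c i := odflt (a0 i) [pick a : Act i | Tagged Act a \in A].
exists c; apply/fintype.subsetP => -[i a] aA; rewrite Tagged_choice_set /c.
case: pickP => [b bA|/(_ a)]; last by rewrite aA.
have /card_le1_eqP/(_ (Tagged Act a) (Tagged Act b)) := AI i.
rewrite !inE !in_block aA bA !eqxx => /(_ isT isT)/eqP.
by rewrite eq_Tagged eq_sym.
Qed.

Definition indicator A : {ffun ground Act -> R} := [ffun e => (e \in A)%:R].

Lemma sum_indicator_choice_set c i :
  \sum_(a : Act i) indicator (choice_set c) (Tagged Act a) = 1.
Proof.
rewrite (bigD1 (c i)) //= ffunE Tagged_choice_set eqxx big1 ?addr0 // => a.
by rewrite ffunE Tagged_choice_set => /negPf ->.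
Qed.

Lemma policy_face_choice_set c : policy_face R Act (indicator (choice_set c)).
Proof.
split; last exact: sum_indicator_choice_set.
split=> [e|i]; last by rewrite sum_indicator_choice_set.
by rewrite ffunE; case: (e \in _); rewrite /= ?lexx ler01.
Qed.

(** The indicator puts mass 1 on the chosen action of each block, so an empty trace gets weight 1 -
    1 = 0 and a singleton trace gets 1 only if it is the chosen one. *)
Lemma agent_weight_choice_set c i A : A \in indep Act ->
  agent_weight i A (indicator (choice_set c)) =
  (A :&: block Act i == choice_set c :&: block Act i)%SET%:R.
Proof.
rewrite inE => /forallP/(_ i) AI; rewrite -agent_weightI choice_set_blockI.
case: (block_partial_choice (finset.subsetIr A _) AI) => [->|[a ->]].
  rewrite agent_weight0 sum_indicator_choice_set subrr.
  by rewrite eq_sym -cards_eq0 cards1.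
rewrite agent_weight_set1 ffunE Tagged_choice_set.
by rewrite (inj_eq (@finset.set1_inj _)) eq_Tagged.
Qed.

Lemma multilinear_ext_choice_set (F : {set ground Act} -> R) c :
  multilinear_ext F (indicator (choice_set c)) = F (choice_set c).
Proof.
rewrite /multilinear_ext (bigD1 (choice_set c)) ?choice_set_indep //=.
rewrite [X in _ * X]big1 ?mulr1 => [|i _]; last first.
  by rewrite agent_weight_choice_set ?choice_set_indep ?eqxx.
rewrite big1 ?addr0 // => A /andP[AI Ac].
(* An independent set other than the choice set differs from it in some block, and that single
   factor kills its product. *)
have /existsP[i Aci] :
    [exists i, A :&: block Act i != choice_set c :&: block Act i]%SET.
  apply: contraNT Ac; rewrite negb_exists => /forallP AE.
  by apply/eqP/eq_blocks => i; apply/eqP; rewrite -[_ == _]negbK.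
by rewrite (bigD1 i) //= agent_weight_choice_set // (negPf Aci) mul0r mulr0.
Qed.

(** A maximiser over the finite family of independent sets extends to a choice set, and monotonicity
    keeps the value from dropping. *)
Lemma max_indep_choice_set (F : {set ground Act} -> R) :
  (forall i, (0 < #|Act i|)%N) -> monotone_setfun F ->
  exists c, forall A, A \in indep Act -> F A <= F (choice_set c).
Proof.
move=> Act_gt0 Fmono.
have I0 : finset.set0 \in indep Act.
  by rewrite inE; apply/forallP => i; rewrite finset.set0I cards0.
case: (arg_maxP F I0) => B BI Bmax.
have [c Bc] := indep_sub_choice_set Act_gt0 BI.
by exists c => A AI; apply: le_trans (Bmax A AI) (Fmono _ _ Bc).
Qed.

End PartitionWeights.

Theorem lemma3 (R : realType) (T : nat) (Agent : choiceType)
    (N : 'I_T -> {fset Agent}) (Act : Agent -> finType)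
    (S : 'I_T -> Type)
    (F : forall t : 'I_T, S t ->
           {set ground (active_actions (N t) Act)} -> R)
    (F_ge0 : forall t s A, 0 <= F t s A)
    (F_normalized : forall t s, normalized (F t s))
    (F_monotone : forall t s, monotone_setfun (F t s))
    (F_submodular : forall t s, submodular (F t s))
    (Act_neq0 : forall t i, i \in N t -> (0 < #|Act i|)%N) :
  forall (t : 'I_T) (s : S t),
    exists m : R,
      [/\ is_max [set multilinear_ext (F t s) x
                  | x in polytope R (active_actions (N t) Act)]%classic m,
          is_max [set multilinear_ext (F t s) x
                  | x in policy_face R (active_actions (N t) Act)]%classic m
        & is_max [set F t s A
                  | A in [set` indep (active_actions (N t) Act)]]%classic m].
Proof.
move=> t s.
have Act_gt0 (i : N t) : (0 < #|active_actions (N t) Act i|)%N.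
  exact: Act_neq0 (valP i).
have [c cmax] := max_indep_choice_set Act_gt0 (F_monotone t s).
have cface := policy_face_choice_set R c.
exists (F t s (choice_set c)); split; split.
- exists (indicator R (choice_set c)); first by case: cface.
  exact: multilinear_ext_choice_set.
- by move=> _ [x xP <-]; exact: multilinear_ext_le.
- by exists (indicator R (choice_set c)); rewrite ?multilinear_ext_choice_set.
(* The face lies in the polytope, so it inherits the same upper bound. *)
- by move=> _ [x [xP _] <-]; exact: multilinear_ext_le.
- by exists (choice_set c) => //; exact: choice_set_indep.
- by move=> _ [A AI <-]; exact: cmax.
Qed.
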